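(* For every $\varepsilon$ with $0<\varepsilon\le 1$, there exist integers $n_0,d\ge 0$ such that if a graph $G$ on $n\ge n_0$ vertices has at least $n^{1+\varepsilon}$ edges, then $G$ contains the complete graph $K_{\lfloor n^{\varepsilon/6}\rfloor}$ as a $d$-minor.
   Context: For a graph $G$ and $d\ge 0$, a $d$-minor of $G$ is any graph obtained from $G$ by contracting pairwise vertex-disjoint connected subgraphs of radius at most $d$ and removing vertices and edges. *)

(* Defs.v *)
From mathcomp Require Import all_boot.

Set Implicit Arguments.
Unset Strict Implicit.
Unset Printing Implicit Defensive.

Record graph := Graph {
  vertex :> finType;
  adj : rel vertex;
  adj_sym : symmetric adj;
  adj_irrefl : irreflexive adj
}.

Definition edges (G : graph) : {set {set G}} :=
  [set A : {set G} | [exists x : G, exists y : G,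
                        adj x y && (A == [set x; y])]].

Definition complete_adj (m : nat) : rel 'I_m := fun x y => x != y.

Lemma complete_adj_sym m : symmetric (@complete_adj m).
Proof. by move=> x y; rewrite /complete_adj eq_sym. Qed.

Lemma complete_adj_irrefl m : irreflexive (@complete_adj m).
Proof. by move=> x; rewrite /complete_adj eqxx. Qed.

Definition complete (m : nat) : graph :=
  Graph (@complete_adj_sym m) (@complete_adj_irrefl m).

Definition connected (G : graph) : Prop :=
  0 < #|G| /\ forall x y : G, connect (@adj G) x y.

Definition walk_of_length (G : graph) (k : nat) (x y : G) : bool :=
  [exists p : k.-tuple G, path (@adj G) x p && (last x p == y)].

(* Shortest walk length; vertices in different components get the junk value
   #|G|, larger than any distance inside a component. *)
Definition dist (G : graph) (x y : G) : nat :=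
  find (fun k => walk_of_length k x y) (iota 0 #|G|).

Definition eccentricity (G : graph) (x : G) : nat := \max_(y : G) dist x y.

(* The default #|G| of the minimum is never reached when G is connected. *)
Definition radius (G : graph) : nat := \big[minn/#|G|]_(x : G) eccentricity x.

(* f exhibits H as (an isomorphic copy of) a subgraph of G, not necessarily
   induced: what remains of G after deleting vertices and edges. *)
Definition subgraph_embedding (H G : graph) (f : H -> G) : Prop :=
  injective f /\ forall x y : H, adj x y -> adj (f x) (f y).

(* Contraction of the vertex sets B i of G: one vertex [inl i] for each B i, and
   one vertex [inr x] for each x outside all of them. Loops and parallel edges
   are suppressed. *)
Section Contraction.
Variables (G : graph) (I : finType) (B : I -> {set G}).

Definition contract_vertex : finType :=
  (I + {x : G | x \notin \bigcup_i B i})%type.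

Definition bag (u : contract_vertex) : {set G} :=
  match u with inl i => B i | inr x => [set val x] end.

Definition contract_adj : rel contract_vertex := fun u v =>
  (u != v) && [exists x in bag u, exists y in bag v, adj x y].

Lemma contract_adj_sym : symmetric contract_adj.
Proof.
move=> u v; rewrite /contract_adj eq_sym; congr andb.
by apply/exists_inP/exists_inP => -[x xu /exists_inP[y yv xy]];
  exists y => //; apply/exists_inP; exists x => //; rewrite adj_sym.
Qed.

Lemma contract_adj_irrefl : irreflexive contract_adj.
Proof. by move=> u; rewrite /contract_adj eqxx. Qed.

Definition contract : graph := Graph contract_adj_sym contract_adj_irrefl.

End Contraction.

(* H is obtained from G by contracting the pairwise vertex-disjoint subgraphs
   S i (embedded by f i) and passing to a subgraph. *)
Definition is_d_minor (d : nat) (H G : graph) : Prop :=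
  exists (I : finType) (S : I -> graph) (f : forall i, S i -> G),
    [/\ forall i, subgraph_embedding (f i),
        forall i j, i != j -> [disjoint codom (f i) & codom (f j)],
        forall i, connected (S i) /\ radius (S i) <= d
      & exists g : H -> contract (fun i => [set x in codom (f i)]),
          subgraph_embedding g].

(* Main.v *)
Require Import Defs.
From mathcomp Require Import all_boot all_order all_algebra.
From mathcomp Require Import boolp reals exp ring lra.

Set Implicit Arguments.
Unset Strict Implicit.
Unset Printing Implicit Defensive.

Import Order.TTheory GRing.Theory Num.Theory.

(** Write n = |G|. Take delta much smaller than eps and let H be a vertex set
    maximizing e(S) / |S|^(1+delta), with maximum c >= n^(eps-delta). By
    maximality every S in H meets at least c |S| |H|^delta arcs of H, whereas
    its closed neighbourhood S' spans at most c |S'|^(1+delta), so that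
    4 |S'|^(1+delta) >= |S| |H|^delta; this survives the deletion of any c / 4
    vertices. Hence the deficit log (|H| / |S|) shrinks by the factor 1 + delta
    at each step, up to an additive constant, and a ball of bounded radius r has
    at least |H| / q vertices, where q is a tiny power of n. So among any q + 1
    vertices of H, two are joined by a path of length O(r) avoiding the deleted
    set.

    Fix T vertices of H, with T slightly below n^(eps/2), and greedily join as
    many pairs of them as possible by internally disjoint paths of length O(r);
    only O(T^2) vertices are used. The joined pairs form a dense graph on the T
    vertices, its independence number being at most q. Dependent random choice
    yields t = n^(eps/6) of the T vertices with more than t^2 common neighbours
    for each pair, hence a subdivision of K_t whose edges are replaced by two
    consecutive paths through a private middle vertex; cutting these next to the
    middle vertices gives the bags of the minor. *)

(** * Shallow clique minors from bags *)

(** [find] never exceeds [#|G|], so only walks shorter than [#|G|] need an argument: such a [p] is a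
    witness at index [size p]. *)
Lemma dist_leq (G : graph) (x : G) (p : seq G) :
  path (@adj G) x p -> dist x (last x p) <= size p.
Proof.
move=> xp; rewrite /dist leqNgt; apply/negP => lt_find.
have lt_pG : size p < #|G|.
  by rewrite -[#|G|](size_iota 0) (leq_trans lt_find) ?find_size.
have := before_find 0 lt_find; rewrite nth_iota ?add0n //.
move/negbT/negP; apply; apply/existsP.
by exists (in_tuple p); rewrite /= xp eqxx.
Qed.

Lemma bigmin_seq_leq (I : eqType) (m : nat) (F : I -> nat) (r : seq I) (i : I) :
  i \in r -> \big[minn/m]_(j <- r) F j <= F i.
Proof.
elim: r => // j r IH; rewrite inE big_cons geq_min.
by case/predU1P=> [->|/IH ->]; rewrite ?leqnn ?orbT.
Qed.

Section InducedGraph.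
Variables (G : graph) (B : {set G}).

Definition induced_adj : rel {x | x \in B} := fun x y => adj (val x) (val y).

Lemma induced_adj_sym : symmetric induced_adj.
Proof. by move=> x y; rewrite /induced_adj adj_sym. Qed.

Lemma induced_adj_irrefl : irreflexive induced_adj.
Proof. by move=> x; rewrite /induced_adj adj_irrefl. Qed.

Definition induced : graph := Graph induced_adj_sym induced_adj_irrefl.

Lemma induced_path (c : induced) (p : seq G) :
  path (@adj G) (val c) p -> all [in B] p ->
  exists2 p' : seq induced, path (@adj induced) c p' & map val p' = p.
Proof.
elim: p c => [|y p IH] c /=; first by exists [::].
case/andP=> cy yp /andP[yB pB].
have [p' yp' <-] := IH (exist _ y yB) yp pB.
by exists (exist _ y yB :: p') => //=; rewrite yp' andbT.
Qed.

Lemma radius_induced_leq d (c : G) : c \in B ->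
    (forall x, x \in B -> exists p,
       [/\ size p <= d, path (@adj G) c p, all [in B] p & last c p = x]) ->
  connected induced /\ radius induced <= d.
Proof.
move=> cB reach; pose c' : induced := exist _ c cB.
have reach' (x : induced) : exists p : seq induced,
    [/\ size p <= d, path (@adj induced) c' p & last c' p = x].
  have [p [pd cp pB lp]] := reach _ (valP x).
  have [p' cp' pE] := @induced_path c' p cp pB.
  exists p'; split=> //; first by rewrite -(size_map val) pE.
  by apply: val_inj; rewrite -last_map pE.
have cconn x : connect (@adj induced) c' x.
  by have [p [_ cp lp]] := reach' x; apply/connectP; exists p.
have csym : connect_sym (@adj induced).
  exact/sym_connect_sym/adj_sym.
split.
  split; first by apply/card_gt0P; exists c'.
  by move=> x y; apply: (connect_trans _ (cconn y)); rewrite csym.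
apply: leq_trans (bigmin_seq_leq _ _ (mem_index_enum c')) _.
apply/bigmax_leqP => x _; have [p [pd cp <-]] := reach' x.
exact: leq_trans (dist_leq cp) pd.
Qed.

End InducedGraph.

(** The contracted subgraphs are those induced on the bags [B i]; the eccentricity of [c i] bounds
    their radius. *)
Lemma is_d_minor_complete (G : graph) (t d : nat) (B : 'I_t -> {set G})
    (c : 'I_t -> G) :
    (forall i, c i \in B i) ->
    (forall i x, x \in B i -> exists p,
       [/\ size p <= d, path (@adj G) (c i) p, all [in B i] p
         & last (c i) p = x]) ->
    (forall i j, i != j -> [disjoint B i & B j]) ->
    (forall i j, i != j -> exists x y, [/\ x \in B i, y \in B j & adj x y]) ->
  is_d_minor d (complete t) G.
Proof.
move=> cB reach disjB adjB.
exists 'I_t, (fun i => induced (B i)), (fun i => val).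
have codomE i : codom (val : induced (B i) -> G) =i B i.
  move=> x; apply/codomP/idP => [[y ->]|xB]; first exact: valP.
  by exists (exist _ x xB).
split=> [i|i j ij|i|].
- by split=> //; apply: val_inj.
- by rewrite (eq_disjoint (codomE i)) (eq_disjoint_r (codomE j)) disjB.
- exact: radius_induced_leq (cB i) (reach i).
exists inl; split=> [i j []//|i j ij] /=.
have [x [y [xi yj xy]]] := adjB i j ij.
rewrite /contract_adj; apply/andP; split.
  by apply: contra ij => /eqP[->].
apply/exists_inP; exists x; first by rewrite inE codomE.
by apply/exists_inP; exists y; rewrite // inE codomE.
Qed.

(** A greedy choice works: the representatives already chosen are fewer than [size s], so they never
    exhaust [F i]. *)
Lemma distinct_representatives (I : eqType) (V : finType) (v0 : V) (s : seq I)
    (F : I -> {set V}) : uniq s -> (forall i, i \in s -> size s <= #|F i|) ->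
  exists z : I -> V, {in s &, injective z} /\ {in s, forall i, z i \in F i}.
Proof.
elim: s => [|a s IH] /=; first by exists (fun=> v0).
case/andP=> aNs us leF.
have [|z [zinj zF]] := IH us.
  by move=> i si; apply: ltnW; apply: leF; rewrite inE si orbT.
have /card_gt0P[v] : 0 < #|F a :\: [set x in map z s]|.
  rewrite cardsD subn_gt0 (leq_trans _ (leF a _)) ?mem_head // ltnS.
  apply: leq_trans (subset_leq_card (subsetIr _ _)) _.
  by rewrite cardsE -(size_map z) card_size.
rewrite !inE => /andP[vNz vFa].
exists (fun i => if i == a then v else z i); split=> [i j|i].
  have zv k : k \in s -> z k <> v.
    by move=> ks zk; case/negP: vNz; rewrite -zk map_f.
  rewrite !inE; have [-> _|_ /= si] := eqVneq i a;
    have [-> _|_ /= sj] := eqVneq j a => //.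
  - by move=> e; case: (zv j sj).
  - by move=> e; case: (zv i si).
  exact: zinj.
by rewrite inE; have [->|_ /= /zF] := eqVneq i a.
Qed.

(** * Dependent random choice *)

Section DependentRandomChoice.
Variables (V : finType) (C : {set V}) (L : rel V).
Hypothesis L_sym : symmetric L.

Definition nbrs_in (u : V) : {set V} := [set z in C | L u z].

(** Pick [u] in [A] and discard it with its neighbours, at most [s] vertices in all; [A] is large
    enough to repeat this until [k.+1] vertices are picked. *)
Lemma low_degree_independent (s k : nat) (A : {set V}) :
    A \subset C -> (forall u, u \in A -> #|nbrs_in u| < s) -> k * s < #|A| ->
  exists2 J : {set V}, J \subset A &
    k < #|J| /\ {in J &, forall u v, u != v -> ~~ L u v}.
Proof.
elim: k A => [|k IH] A AC degA ltA.
  have /card_gt0P[u uA] : 0 < #|A| by apply: leq_trans ltA.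
  exists [set u]; first by rewrite sub1set.
  by rewrite cards1; split=> // x y /set1P-> /set1P->; rewrite eqxx.
have /card_gt0P[u uA] : 0 < #|A| by apply: leq_trans ltA.
pose A' := A :\: (u |: nbrs_in u).
have sA'A : A' \subset A by apply: subsetDl.
have [||| J sJ [cJ indJ]] := IH A'.
- exact: subset_trans AC.
- by move=> v /(subsetP sA'A); apply: degA.
- rewrite cardsD ltn_subRL; apply: leq_ltn_trans ltA.
  rewrite mulSn leq_add2r (leq_trans (subset_leq_card (subsetIr _ _))) //.
  rewrite (leq_trans (leq_card_setU _ _)) // cards1 add1n; exact: degA.
have uJ v : v \in J -> (u != v) && ~~ L u v.
  move=> vJ; have := subsetP sJ _ vJ; rewrite !inE negb_or eq_sym.
  case/andP=> /andP[-> /=] + vA; by rewrite (subsetP AC _ vA).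
exists (u |: J).
  by rewrite subUset sub1set uA (subset_trans sJ).
split.
  rewrite cardsU1 (_ : u \in J = false) ?add1n //.
  by apply/negP => /uJ; rewrite eqxx.
move=> x y /setU1P[->|xJ] /setU1P[->|yJ]; rewrite ?eqxx // => xy.
- by have /andP[] := uJ _ yJ.
- by rewrite L_sym; have /andP[] := uJ _ xJ.
exact: indJ.
Qed.

(** The sum is the unnormalised probability that [k] random elements of [C] all fall in [A]. *)
Lemma card_tuples_on (k : nat) (A : {set V}) :
  \sum_(z : {ffun 'I_k -> V} | [forall i, z i \in C]) [forall i, z i \in A]
    <= #|A| ^ k.
Proof.
rewrite -[k in _ ^ k]card_ord -card_ffun_on -sum1_card.
rewrite [leqLHS]big_mkcond [leqRHS]big_mkcond /=; apply: leq_sum => z _.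
have -> : (z \in ffun_on (mem A)) = [forall i, z i \in A] by [].
by do 2!case: ifP => //; case: [forall _, _].
Qed.

Lemma card_tuples_on_sub (k : nat) (A : {set V}) : A \subset C ->
  \sum_(z : {ffun 'I_k -> V} | [forall i, z i \in C]) [forall i, z i \in A]
    = #|A| ^ k.
Proof.
move=> AC; rewrite -[k in _ ^ k]card_ord -card_ffun_on -sum1_card.
rewrite [LHS]big_mkcond [RHS]big_mkcond /=; apply: eq_bigr => z _.
have -> : (z \in ffun_on (mem A)) = [forall i, z i \in A] by [].
have [zA|_] := boolP [forall i, z i \in A]; last by case: ifP.
rewrite ifT //; apply/forallP => i; apply: (subsetP AC); exact: (forallP zA).
Qed.

(* Averaging over the k-tuples z of elements of C: the common neighbourhood of z
   is large, while few of its pairs have small codegree. *)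
Lemma dependent_random_choice (k s m t q : nat) : 0 < k ->
    (forall A : {set V}, A \subset C -> q < #|A| ->
       exists u v, [/\ u \in A, v \in A, u != v & L u v]) ->
    (q * s).*2 <= #|C| ->
    (#|C| ^ 2 * m ^ k + #|C| ^ k * t).*2 < #|C| * s ^ k ->
  exists W : {set V}, [/\ W \subset C, t <= #|W|
    & {in W &, forall u v, u != v -> m <= #|nbrs_in u :&: nbrs_in v|}].
Proof.
move=> k_gt0 alpha leqs ltm.
pose low := [set u in C | #|nbrs_in u| < s].
have lowC : low \subset C by apply/subsetP => u; rewrite inE => /andP[].
have card_low : #|low| <= q * s.
  rewrite leqNgt; apply/negP => lt_low.
  have [|J sJ [cJ indJ]] := @low_degree_independent s q low lowC _ lt_low.
    by move=> u; rewrite inE => /andP[].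
  have [u [v [uJ vJ uv Luv]]] := alpha J (subset_trans sJ lowC) cJ.
  by have := indJ u v uJ vJ uv; rewrite Luv.
pose Z z := [forall i : 'I_k, (z : {ffun 'I_k -> V}) i \in C].
pose W (z : {ffun 'I_k -> V}) :=
  [set u in C | [forall i, z i \in nbrs_in u]].
pose bad := [set p : V * V | [&& p.1 \in C, p.2 \in C, p.1 != p.2
  & #|nbrs_in p.1 :&: nbrs_in p.2| < m]].
pose badW z := [set p in bad | (p.1 \in W z) && (p.2 \in W z)].
(* Double counting: [u] lies in [W z] for [#|nbrs_in u| ^ k] tuples [z], and at least half of [C]
   has degree at least [s]. *)
have sumW : #|C| * s ^ k <= (\sum_(z | Z z) #|W z|).*2.
  have -> : \sum_(z | Z z) #|W z| = \sum_(u in C) #|nbrs_in u| ^ k.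
    transitivity (\sum_(z | Z z) \sum_(u in C) [forall i, z i \in nbrs_in u]).
      apply: eq_bigr => z _; rewrite -sum1_card.
      rewrite [RHS]big_mkcond [LHS]big_mkcond /=.
      apply: eq_bigr => u _; rewrite inE.
      by case: (u \in C) => //; case: ifP.
    rewrite exchange_big; apply: eq_bigr => u _; apply: card_tuples_on_sub.
    by apply/subsetP => z; rewrite inE => /andP[].
  apply: (@leq_trans (\sum_(u in C :\: low) s ^ k).*2).
    rewrite sum_nat_const doubleMl leq_mul2r; apply/orP; right.
    rewrite cardsD (setIidPr lowC) doubleB -[#|C|.*2]addnn -addnBA ?leq_addr //.
    by rewrite (leq_trans _ leqs) // leq_double.
  rewrite leq_double [leqRHS]big_mkcond [leqLHS]big_mkcond leq_sum // => u _.
  rewrite !inE; case: (u \in C) => //=; case: ltnP => //= lesu.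
  by rewrite leq_exp2r.
(* A bad pair survives in [W z] only if [z] stays within its common neighbourhood, which has fewer
   than [m] vertices. *)
have sumbad : \sum_(z | Z z) #|badW z| <= #|C| ^ 2 * m ^ k.
  have -> : \sum_(z | Z z) #|badW z| = \sum_(z | Z z) \sum_(p in bad)
      [forall i, z i \in nbrs_in p.1 :&: nbrs_in p.2].
    apply: eq_bigr => z _; rewrite -sum1_card.
    rewrite [RHS]big_mkcond [LHS]big_mkcond /=.
    apply: eq_bigr => p _; rewrite [p \in badW z]in_set.
    have [pbad /=|//] := boolP (p \in bad).
    have /andP[p1C p2C] : (p.1 \in C) && (p.2 \in C).
      by move: pbad; rewrite in_set => /and4P[-> ->].
    rewrite ![_ \in W z]in_set p1C p2C /= (_ : [forall i, z i \in _ :&: _] =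
       [forall i, z i \in nbrs_in p.1] && [forall i, z i \in nbrs_in p.2]);
      first by case: (_ && _).
    apply/forallP/andP => [h|[/forallP h1 /forallP h2] i].
      by split; apply/forallP => i; have := h i; rewrite inE => /andP[].
    by rewrite inE h1 h2.
  rewrite exchange_big /=; apply: (@leq_trans (\sum_(p in bad) m ^ k)).
    apply: leq_sum => p; rewrite inE => /and4P[_ _ _ ltp].
    apply: leq_trans (card_tuples_on _ _) _; by rewrite leq_exp2r // ltnW.
  rewrite sum_nat_const leq_mul2r -mulnn -cardsX; apply/orP; right.
  by apply/subset_leq_card/subsetP => p; rewrite !inE => /and4P[-> ->].
have [z Zz ltW] : exists2 z, Z z & #|badW z| + t < #|W z|.
  apply/exists_inP; apply: contraTT ltm => /exists_inPn small.
  rewrite -leqNgt (leq_trans sumW) // leq_double.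
  apply: (@leq_trans (\sum_(z | Z z) (#|badW z| + t))).
    by apply: leq_sum => z /small; rewrite -leqNgt.
  rewrite big_split /= leq_add // sum_nat_const leq_mul2r; apply/orP; right.
  rewrite -[k in _ ^ k]card_ord -card_ffun_on.
  exact/subset_leq_card/subsetP.
(* Deleting the first vertex of every bad pair costs at most [#|badW z|] vertices. *)
exists [set u in W z | [forall v, (u, v) \notin badW z]]; split.
- by apply/subsetP => u; rewrite !inE => /andP[/andP[]].
- set W' := [set u in _ | _].
  have -> : W' = W z :\: [set p.1 | p in badW z].
    apply/setP => u; rewrite inE in_setD andbC; congr (_ && _).
    apply/forallP/negP => [h /imsetP[[u' v] /= + uu']|h v].
      by rewrite -uu' (negPf (h v)).
    by apply/negP => uv; apply: h; apply/imsetP; exists (u, v).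
  rewrite cardsD leq_subRL; last exact/subset_leq_card/subsetIl.
  apply: leq_trans (ltnW ltW); rewrite leq_add2r.
  by rewrite (leq_trans (subset_leq_card (subsetIr _ _))) ?leq_imset_card.
move=> u v; rewrite in_set => /andP[uW /forallP/(_ v) nb].
rewrite in_set => /andP[vW _] uv; rewrite leqNgt; apply: contra nb => lt_m.
rewrite in_set /= uW vW andbT in_set /= uv lt_m andbT.
by move: uW vW; rewrite !in_set => /andP[-> _] /andP[-> _].
Qed.

End DependentRandomChoice.

(** * Linkages *)

(* p lists the inner vertices of a walk from u to v that avoids X, except
   possibly at its ends. *)
Definition link (G : graph) (X : {set G}) (l : nat) (u v : G) (p : seq G) :=
  [&& size p <= l, path (@adj G) u (rcons p v) & all [predC X] p].

Lemma path_adj_rev (G : graph) (u v : G) (p : seq G) :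
  path (@adj G) u (rcons p v) -> path (@adj G) v (rcons (rev p) u).
Proof.
have := rev_path (@adj G) u (rcons p v).
rewrite last_rcons belast_rcons rev_cons => ->.
by rewrite (eq_path (e' := @adj G)) // => x y; rewrite adj_sym.
Qed.

Lemma link_rev (G : graph) (X : {set G}) l u v p :
  link X l u v p -> link X l v u (rev p).
Proof.
case/and3P=> pl up pX; rewrite /link size_rev pl all_rev pX andbT /=.
exact: path_adj_rev.
Qed.

(** Pairs are treated one at a time, each being linked if some path avoids [C] and all earlier
    paths. A rejected pair stays rejected, since the forbidden set only grows. *)
Lemma greedy_linkage (G : graph) (C : {set G}) (l : nat) (s : seq (G * G)) :
  exists (K : seq (G * G)) (P : G * G -> seq G),
    [/\ size K <= size s, {subset K <= s},
        {in K, forall e, link C l e.1 e.2 (P e)},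
        {in K &, forall e e', e != e' -> forall x, x \in P e -> x \notin P e'}
      & {in s, forall e, e \notin K -> forall p,
           ~~ link (C :|: [set x in flatten (map P K)]) l e.1 e.2 p}].
Proof.
elim: s => [|a s [K [P [szK sK linkK disjK maxK]]]].
  by exists [::], (fun=> [::]).
have sK' e : e \in K -> e \in a :: s by rewrite inE => /sK ->; rewrite orbT.
pose Y := C :|: [set x in flatten (map P K)].
have [aK|aNK] := boolP (a \in K).
  exists K, P; split=> //= [|e]; first exact: leqW.
  rewrite inE => /predU1P[->|/maxK //]; by rewrite aK.
have [[p linkp]|nolink] := pselect (exists p, link Y l a.1 a.2 p); last first.
  exists K, P; split=> //= [|e]; first exact: leqW.
  rewrite inE => /predU1P[-> _ p|/maxK //].
  by apply/negP => linkp; apply: nolink; exists p.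
pose P' e := if e == a then p else P e.
have P'E : {in K, P' =1 P}.
  by move=> e eK; rewrite /P'; case: eqP => // ea; rewrite -ea eK in aNK.
have P'a : P' a = p by rewrite /P' eqxx.
have pY x : x \in p -> (x \notin C) && (x \notin flatten (map P K)).
  case/and3P: linkp => _ _ /allP pX /pX; by rewrite /= !inE negb_or.
have P'K : map P' K = map P K by apply/eq_in_map.
have pK x e : e \in K -> x \in P e -> x \notin p.
  move=> eK xPe; apply/negP => /pY/andP[_ /negP]; apply.
  by apply/flattenP; exists (P e); rewrite ?map_f.
exists (a :: K), P'; split=> //=.
- by move=> e; rewrite !inE => /predU1P[->|/sK ->]; rewrite ?eqxx ?orbT.
- move=> e; rewrite inE => /predU1P[->|eK]; last first.
    by rewrite P'E //; apply: linkK.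
  rewrite P'a; case/and3P: linkp => pl ap _; rewrite /link pl ap.
  by apply/allP => x /pY /andP[].
- move=> e e'; rewrite !inE => /predU1P[->|eK] /predU1P[->|e'K].
  + by rewrite eqxx.
  + move=> _ x; rewrite P'a P'E // => xp.
    by apply: contraL xp; apply: pK.
  + by move=> _ x; rewrite P'a P'E //; apply: pK.
  by rewrite !P'E //; apply: disjK.
move=> e; rewrite !inE negb_or => /predU1P[->|es]; first by rewrite eqxx.
case/andP=> _ eNK r; apply: contra (maxK e es eNK r).
case/and3P=> rl er /allP rX; rewrite /link rl er; apply/allP => x /rX.
rewrite /= P'K !inE mem_cat !negb_or; by case/and3P=> -> _ ->.
Qed.

Lemma size_flatten_leq (T : Type) (ss : seq (seq T)) (l : nat) :
  all (fun s => size s <= l) ss -> size (flatten ss) <= l * size ss.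
Proof.
elim: ss => //= s ss IH /andP[sl /IH le]; by rewrite size_cat mulnS leq_add.
Qed.

(** * Bags from a subdivided clique *)

Section CliqueFromLinks.
Variables (G : graph) (C : {set G}) (l t : nat) (K : seq (G * G)).
Variables (P : G * G -> seq G) (w : 'I_t -> G).
Variable z : 'I_t * 'I_t -> G.
Hypothesis linkK : {in K, forall e, link C l e.1 e.2 (P e)}.
Hypothesis disjK :
  {in K &, forall e e', e != e' -> forall x, x \in P e -> x \notin P e'}.
Hypothesis w_inj : injective w.
Hypothesis w_in : forall i, w i \in C.
Hypothesis z_inj : forall i j i' j',
  i != j -> i' != j' -> z (i, j) = z (i', j') -> (i, j) = (i', j').
Hypothesis z_in : forall i j, i != j -> z (i, j) \in C.
Hypothesis z_w : forall i j k, i != j -> z (i, j) != w k.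
Hypothesis zK : forall i j, i != j ->
  (w i, z (i, j)) \in K /\ (w j, z (i, j)) \in K.

(** A bag splits into a part inside [C], namely [w i] and its middle vertices, and a part outside
    [C], the inner vertices of all chosen paths starting at [w i]. Each ordered pair has its own
    middle vertex, owned by its first index. *)
Let branch i := [set x | (x == w i) || [exists j, (i != j) && (x == z (i, j))]].
Let inner i := [set x | [exists v, ((w i, v) \in K) && (x \in P (w i, v))]].
Let B i := branch i :|: inner i.

Let branch_in i x : x \in branch i -> x \in C.
Proof.
rewrite inE => /predU1P[->|/existsP[j /andP[ij /eqP->]]] //; exact: z_in.
Qed.

Let inner_notin i x : x \in inner i -> x \notin C.
Proof.
rewrite inE => /existsP[v /andP[/linkK/and3P[_ _ /allP PC] /PC]]; exact.
Qed.

Let w_B i : w i \in B i.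
Proof. by rewrite !inE eqxx. Qed.

Let z_B i j : i != j -> z (i, j) \in B i.
Proof.
move=> ij; rewrite !inE; apply/orP; left; apply/orP; right.
by apply/existsP; exists j; rewrite ij eqxx.
Qed.

Let P_B i v x : (w i, v) \in K -> x \in P (w i, v) -> x \in B i.
Proof.
move=> ivK xP; rewrite !inE; apply/orP; right.
by apply/existsP; exists v; rewrite ivK.
Qed.

Lemma clique_from_links : is_d_minor l.+1 (complete t) G.
Proof.
apply: (@is_d_minor_complete G t l.+1 B w) => // [i x|i j ij|i j ij].
- rewrite in_setU => /orP[|]; rewrite inE.
    case/predU1P=> [->|/existsP[j /andP[ij /eqP->]]]; first by exists [::].
    have [iK _] := zK ij; have /and3P[/= Pl Pp _] := linkK iK.
    exists (rcons (P (w i, z (i, j))) (z (i, j))); split=> //.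
    + by rewrite size_rcons ltnS.
    + rewrite all_rcons z_B //=; apply/allP => y; exact: P_B.
    by rewrite last_rcons.
  case/existsP=> v /andP[ivK xP].
  have /and3P[/= Pl Pp _] := linkK ivK.
  have PB := fun y => @P_B i v y ivK.
  case/splitPr: xP Pl Pp PB => p1 p2 Pl; rewrite rcons_cat cat_path /=.
  case/and3P=> Pp1 p1x _ PB; exists (rcons p1 x); split.
  + rewrite size_rcons ltnS; apply: leq_trans Pl; by rewrite size_cat leq_addr.
  + by rewrite rcons_path Pp1.
  + by apply/allP => y; rewrite -cats1 mem_cat inE => yp; apply: PB;
      rewrite mem_cat inE; case/orP: yp => ->; rewrite ?orbT.
  by rewrite last_rcons.
- apply/pred0P => x /=; apply/negP; rewrite !in_setU.
  case/andP=> /orP[xi|xi] /orP[xj|xj].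
  + move: xi xj; rewrite !inE.
    case/predU1P=> [->|/existsP[i' /andP[ii' /eqP->]]].
      case/predU1P=> [/w_inj eij|/existsP[j' /andP[jj']]].
        by rewrite eij eqxx in ij.
      by rewrite eq_sym (negPf (z_w _ jj')).
    rewrite (negPf (z_w _ ii')) => /existsP[j' /andP[jj' /eqP]].
    by move/(z_inj ii' jj') => [eij _]; rewrite eij eqxx in ij.
  + by have := inner_notin xj; rewrite (branch_in xi).
  + by have := inner_notin xi; rewrite (branch_in xj).
  move: xi xj; rewrite !inE.
  case/existsP=> v /andP[vK xv] /existsP[v' /andP[vK' xv']].
  have := disjK vK vK' _ xv; rewrite xv' => /(_ _)/negP; apply=> //.
  by apply: contra ij => /eqP[/w_inj-> _].
have [_ jK] := zK ij; have /and3P[/= _ + _] := linkK jK.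
rewrite rcons_path => /andP[_ adjz].
(* The two bags are joined by the final edge of the path from [w j] to [z (i, j)]; that edge starts
   at [w j] itself when the path has no inner vertex. *)
exists (z (i, j)), (last (w j) (P (w j, z (i, j)))).
split; [exact: z_B| |by rewrite adj_sym].
have := mem_last (w j) (P (w j, z (i, j))); rewrite inE => /predU1P[->//|].
exact: P_B.
Qed.

End CliqueFromLinks.

(** Here [X] stands for [C] together with the inner vertices of a maximal linkage. By maximality,
    the first hypothesis says that the graph of joined pairs has no independent set of more than [q]
    vertices. *)
Lemma clique_minor_of_links (G : graph) (C : {set G}) (l q s t : nat) :
    (forall X A : {set G}, C \subset X -> #|X| <= #|C| + l * #|C| ^ 2 ->
       A \subset C -> q < #|A| -> exists u v p,
         [/\ u \in A, v \in A, u != v & link X l u v p]) ->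
    (q * s).*2 <= #|C| ->
    (#|C| ^ 2 * (t ^ 2 + t) ^ 4 + #|C| ^ 4 * t).*2 < #|C| * s ^ 4 ->
  is_d_minor l.+1 (complete t) G.
Proof.
move=> alpha leqs ltt.
have [K [P [szK sK linkK disjK maxK]]] :=
  greedy_linkage C l (enum (setX C C)).
rewrite -cardE cardsX mulnn in szK.
pose X := C :|: [set x in flatten (map P K)].
have CX : C \subset X by apply: subsetUl.
have leX : #|X| <= #|C| + l * #|C| ^ 2.
  rewrite (leq_trans (leq_card_setU _ _)) // leq_add2l cardsE.
  apply: leq_trans (card_size _) _.
  apply: (@leq_trans (l * size (map P K))); last by rewrite size_map leq_mul.
  apply: size_flatten_leq; apply/allP => _ /mapP[e eK ->].
  by have /and3P[] := linkK e eK.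
(* Both orientations are asked for so that [L] is symmetric; reversing a link shows that a linkable
   pair has both. *)
pose L := [rel u v | ((u, v) \in K) && ((v, u) \in K)].
have Lsym : symmetric L by move=> u v; rewrite /= andbC.
have linked u v p : u \in C -> v \in C -> link X l u v p -> (u, v) \in K.
  move=> uC vC; apply: contraTT => uvK; apply: (maxK (u, v)) => //.
  by rewrite mem_enum inE /= uC.
(* Of the [t ^ 2 + t] common neighbours, [t ^ 2] allow distinct middle vertices for all ordered
   pairs and [t] make up for those lying among the [w i]. *)
have [|W [WC leW codegW]] := @dependent_random_choice _ C L Lsym 4 s
    (t ^ 2 + t) t q isT _ leqs ltt.
  move=> A AC ltA; have [u [v [p [uA vA uv linkp]]]] := alpha X A CX leX AC ltA.
  have [uC vC] := (subsetP AC _ uA, subsetP AC _ vA).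
  exists u, v; split=> //=; rewrite (linked u v p) //=.
  exact: linked (link_rev linkp).
case: t leW codegW {ltt} => [_ _|t leW codegW].
  have c0 : 'I_0 -> G by case.
  by apply: (@is_d_minor_complete _ _ _ (fun=> set0) c0); case.
pose w (i : 'I_t.+1) : G := enum_val (widen_ord leW i).
have w_inj : injective w.
  by move=> i j /enum_val_inj/(congr1 val) /= ij; apply: val_inj.
have wW i : w i \in W by apply: enum_valP.
pose I := [seq e <- enum {: 'I_t.+1 * 'I_t.+1} | e.1 != e.2].
pose F (e : 'I_t.+1 * 'I_t.+1) :=
  (nbrs_in C L (w e.1) :&: nbrs_in C L (w e.2)) :\: [set w i | i in 'I_t.+1].
have IE e : (e \in I) = (e.1 != e.2) by rewrite mem_filter mem_enum andbT.
have [||z [z_inj zF]] := @distinct_representatives _ G (w ord0) I F.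
- by rewrite filter_uniq ?enum_uniq.
- move=> e; rewrite IE => ne.
  rewrite cardsD leq_subRL ?subset_leq_card ?subsetIl //.
  have ww : w e.1 != w e.2 by rewrite (inj_eq w_inj).
  apply: leq_trans (codegW _ _ (wW _) (wW _) ww); rewrite addnC leq_add //.
    rewrite (leq_trans (size_subseq (filter_subseq _ _))) //.
    by rewrite -cardE card_prod card_ord mulnn.
  apply: leq_trans (subset_leq_card (subsetIr _ _)) _.
  by rewrite (leq_trans (leq_imset_card _ _)) // card_ord.
have zP i j : i != j -> [/\ z (i, j) \in C, forall k, z (i, j) != w k,
    (w i, z (i, j)) \in K & (w j, z (i, j)) \in K].
  move=> ij; have := zF (i, j); rewrite IE /= ij => /(_ isT).
  rewrite !inE /= => /andP[zNw /andP[/and3P[-> -> _] /and3P[_ -> _]]].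
  split=> // k; apply: contra zNw => /eqP->; exact: imset_f.
apply: (@clique_from_links G C l t.+1 K P w z) => //.
- by move=> i; apply: (subsetP WC).
- by move=> i j i' j' ij ij' /z_inj ->; rewrite ?IE.
- by move=> i j /zP[].
- by move=> i j k /zP[].
by move=> i j /zP[].
Qed.

(** * Expansion in a densest subgraph *)

Local Open Scope ring_scope.

Section Expansion.
Variable G : graph.
Implicit Types S X H : {set G}.

Definition arcs_between S X : {set G * G} :=
  [set e | [&& e.1 \in S, e.2 \in X & adj e.1 e.2]].

Definition arcs S := arcs_between S S.

Lemma card_edges_leq : (#|edges G| <= #|arcs setT|)%N.
Proof.
apply: leq_trans (leq_imset_card (fun e : G * G => [set e.1; e.2]) _).
apply/subset_leq_card/subsetP => A; rewrite inE.
case/existsP=> x /existsP[y /andP[xy /eqP->]].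
by apply/imsetP; exists (x, y); rewrite // !inE.
Qed.

Lemma card_arcs_leq S : (#|arcs S| <= #|S| ^ 2)%N.
Proof.
rewrite -mulnn -cardsX; apply/subset_leq_card/subsetP => e.
by rewrite !inE => /and3P[-> ->].
Qed.

(** Only the new vertices must avoid [X]: the balls grown later are centred at vertices of [X]. *)
Definition grow H X S :=
  S :|: [set y in H :\: X | [exists x in S, adj x y]].

(** An arc of [H] misses [S] or has an end in [S]. By symmetry the latter number at most twice the
    arcs leaving [S], and those lie in [grow H X S] or end in [X]. *)
Lemma card_arcs_grow H X S : S \subset H ->
  (#|arcs H| <= #|arcs (H :\: S)| + (#|arcs (grow H X S)| + #|S| * #|X|).*2)%N.
Proof.
move=> SH.
have swap : #|arcs_between H S| = #|arcs_between S H|.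
  rewrite -(card_imset _ (can_inj (@swap_pairK G G))); apply: eq_card => -[x y].
  apply/imsetP/idP => [[[x' y']]|].
    by rewrite !inE adj_sym => /and3P[? ? ?] [-> ->]; apply/and3P.
  rewrite !inE adj_sym => /and3P[? ? ?].
  by exists (y, x); rewrite // !inE; apply/and3P.
have leSH : (#|arcs_between S H| <= #|arcs (grow H X S)| + #|S| * #|X|)%N.
  rewrite -cardsX; apply: leq_trans (leq_card_setU _ _).
  apply/subset_leq_card/subsetP => -[x y]; rewrite !inE /= => /and3P[xS yH xy].
  rewrite xS yH xy /=; case: (y \in X); rewrite ?orbT //= orbF andbT.
  by apply/orP; right; apply/existsP; exists x; rewrite xS.
apply: (@leq_trans
  (#|arcs (H :\: S)| + #|arcs_between S H| + #|arcs_between H S|)).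
  apply: leq_trans (leq_add (leq_card_setU _ _) (leqnn _)).
  apply: leq_trans (leq_card_setU _ _).
  apply/subset_leq_card/subsetP => -[x y]; rewrite !inE /= => /and3P[-> -> ->].
  by case: (x \in S); case: (y \in S).
by rewrite swap -addnA leq_add2l addnn leq_double.
Qed.

Definition ball H X (u : G) (i : nat) := iter i (grow H X) [set u].

Lemma ball_sub H X u i : u \in H -> ball H X u i \subset H.
Proof.
move=> uH; elim: i => [|i IH] /=; first by rewrite sub1set.
by rewrite subUset IH; apply/subsetP => y; rewrite !inE => /andP[/andP[]].
Qed.

Lemma mem_ball_center H X u i : u \in ball H X u i.
Proof. by elim: i => [|i IH] /=; rewrite inE ?IH. Qed.

Lemma ball_path H X u i v : v \in ball H X u i ->
  exists p, [/\ (size p <= i)%N, path (@adj G) u p, last u p = v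
    & all [predC X] p].
Proof.
elim: i v => [|i IH] v /=; first by move/set1P->; exists [::].
rewrite inE => /orP[/IH[p [pi up lp pX]]|].
  by exists p; split=> //; apply: leqW.
rewrite !inE => /andP[/andP[vX vH] /existsP[x /andP[/IH[p [pi up lp pX]] xv]]].
exists (rcons p v); split.
- by rewrite size_rcons.
- by rewrite rcons_path up lp.
- by rewrite last_rcons.
by rewrite all_rcons /= vX.
Qed.

Lemma ball_meet_link H X u w v i : u \in X -> w \in X -> u != w ->
  v \in ball H X u i -> v \in ball H X w i ->
  exists p, link X i.*2 u w p.
Proof.
move=> uX wX uw /ball_path[p [pi up lp pX]] /ball_path[q [qi wq lq qX]].
(* The meeting vertex is kept on [p] and dropped from [q]. If [q] is empty, then [v = w] lies in
   [X], so [p], which avoids [X], is empty too and [u = w]. *)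
case/lastP: q qi wq lq qX => [|q v'].
  move=> _ _ /= wv; case/lastP: p pi up lp pX => [|p v'].
    by move=> _ _ /= uv; rewrite uv wv eqxx in uw.
  by rewrite last_rcons all_rcons => _ _ -> /= /andP[]; rewrite -wv wX.
rewrite size_rcons last_rcons all_rcons => qi wq v'v; move: wq; rewrite {}v'v.
move=> wq /andP[_ qX]; exists (p ++ rev q); apply/and3P; split.
- by rewrite size_cat size_rev -addnn leq_add // ltnW.
- rewrite rcons_cat cat_path up lp /=.
  exact: path_adj_rev.
by rewrite all_cat pX all_rev.
Qed.

End Expansion.

(** * Growth of balls in an extremal vertex set *)

Section ExtremalSubgraph.
Variables (R : realType) (G : graph) (delta c : R) (H : {set G}).
Hypothesis delta_gt0 : 0 < delta.
Hypothesis c_gt0 : 0 < c.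
Hypothesis H_gt0 : (0 < #|H|)%N.
Hypothesis arcs_le : forall S : {set G},
  #|arcs S|%:R <= c * #|S|%:R `^ (1 + delta).
Hypothesis arcs_H : #|arcs H|%:R = c * #|H|%:R `^ (1 + delta).

Let N : R := #|H|%:R.
Let N_gt0 : 0 < N. Proof. by rewrite ltr0n. Qed.
Let N_ge0 : 0 <= N. Proof. exact: ltW. Qed.
Let c_ge0 : 0 <= c. Proof. exact: ltW. Qed.
Let powN_ge1 : 1 <= N `^ delta.
Proof. by rewrite -[leLHS](powRr0 N) ler_powR ?ler1n // ltW. Qed.

Lemma powR1D (x : R) : 0 <= x -> x `^ (1 + delta) = x * x `^ delta.
Proof.
move=> x_ge0; rewrite powRD ?powRr1 //.
by apply/implyP; rewrite gt_eqF // addr_gt0.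
Qed.

Lemma extremal_card_ge : c <= #|H|%:R.
Proof.
have : c * N `^ (1 + delta) <= N * N.
  by rewrite -arcs_H -natrM ler_nat mulnn card_arcs_leq.
rewrite powR1D // mulrCA ler_pM2l //; apply: le_trans.
by rewrite ler_peMr.
Qed.

(** At least [c * #|S| * N ^ delta] arcs meet [S]. Those through [X] are at most half of them, and
    the others are at most [2 * c * #|grow H X S| ^ (1 + delta)]; hence the factor 4. *)
Lemma grow_expansion (X S : {set G}) : S \subset H -> 4 * #|X|%:R <= c ->
  #|S|%:R * N `^ delta <= 4 * #|grow H X S|%:R `^ (1 + delta).
Proof.
move=> SH leX; have := card_arcs_grow X SH.
rewrite -(ler_nat R) natrD -muln2 natrM natrD natrM arcs_H => le1.
have le2 := arcs_le (grow H X S).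
have le3 : #|arcs (H :\: S)|%:R <= c * ((N - #|S|%:R) * N `^ delta).
  apply: le_trans (arcs_le _) _; rewrite ler_pM2l // powR1D //.
  have -> : N - #|S|%:R = #|H :\: S|%:R.
    by rewrite cardsD (setIidPr SH) natrB ?subset_leq_card.
  apply: ler_wpM2l => //; apply: ge0_ler_powR; rewrite ?nnegrE //.
    exact: ltW.
  by rewrite ler_nat subset_leq_card ?subsetDl.
have cN : c <= c * N `^ delta by rewrite ler_peMr.
have le4 : 4 * (#|S|%:R * #|X|%:R) <= #|S|%:R * (c * N `^ delta).
  by rewrite mulrCA ler_wpM2l // (le_trans leX).
rewrite powR1D // in le1; rewrite -(ler_pM2l c_gt0); lra.
Qed.

Let theta : R := (1 + delta)^-1.

(** In logarithms, one growth step sends a deficit [a] to at most [theta * (a + ln 4)], a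
    contraction with fixed point [ln 4 / delta]. *)
Lemma ball_expansion (X : {set G}) (u : G) (i : nat) : u \in H ->
    4 * #|X|%:R <= c ->
  ln N - ln #|ball H X u i|%:R <= theta ^+ i * ln N + ln 4 / delta.
Proof.
move=> uH leX; have d1_gt0 : 0 < 1 + delta by rewrite addr_gt0.
have ln4_ge0 : 0 <= ln 4 :> R by rewrite ln_ge0 // ler1n.
have ball_gt0 j : 0 < #|ball H X u j|%:R :> R.
  by rewrite ltr0n; apply/card_gt0P; exists u; apply: mem_ball_center.
elim: i => [|i IH].
  rewrite /ball /= cards1 ln1 expr0 subr0 mul1r lerDl divr_ge0 //; exact: ltW.
have := grow_expansion (ball_sub X i uH) leX.
rewrite -ler_ln ?posrE ?mulr_gt0 ?powR_gt0 //; last exact: (ball_gt0 i.+1).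
rewrite !lnM ?posrE ?powR_gt0 //; last exact: (ball_gt0 i.+1).
rewrite !ln_powR -[grow _ _ _]/(ball H X u i.+1).
set x := ln #|ball H X u i|%:R in IH *; set y := ln #|ball H X u i.+1|%:R.
move=> step; rewrite -(ler_pM2l d1_gt0) [leRHS]mulrDr.
have -> : (1 + delta) * (theta ^+ i.+1 * ln N) = theta ^+ i * ln N.
  by rewrite exprS /theta; field; rewrite gt_eqF.
have -> : (1 + delta) * (ln 4 / delta) = ln 4 / delta + ln 4.
  by field; rewrite gt_eqF.
lra.
Qed.

(** Every ball of radius [r] fills at least a fraction [1 / K] of [H], so more than [K] of them
    cannot be pairwise disjoint. *)
Lemma extremal_links (gamma : R) (r : nat) (X A : {set G}) :
    theta ^+ r <= gamma -> 4 * #|X|%:R <= c -> A \subset H -> A \subset X ->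
    4 `^ delta^-1 * #|G|%:R `^ gamma < #|A|%:R ->
  exists u v p, [/\ u \in A, v \in A, u != v & link X r.*2 u v p].
Proof.
move=> le_r leX AH AX ltA.
have G_gt0 : 0 < #|G|%:R :> R by rewrite ltr0n (leq_trans H_gt0) ?max_card.
set K := _ * _ in ltA.
have K_gt0 : 0 < K by rewrite mulr_gt0 ?powR_gt0.
have N_le u : u \in A -> N <= K * #|ball H X u r|%:R.
  move=> uA; have uH := subsetP AH _ uA.
  have b_gt0 : 0 < #|ball H X u r|%:R :> R.
    by rewrite ltr0n; apply/card_gt0P; exists u; apply: mem_ball_center.
  have Kb_gt0 := mulr_gt0 K_gt0 b_gt0; rewrite -ler_ln ?posrE // lnM ?posrE //.
  rewrite /K lnM ?posrE ?powR_gt0 // !ln_powR; have := ball_expansion r uH leX.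
  have lnNG : ln N <= ln #|G|%:R.
    by rewrite ler_ln ?posrE // ler_nat max_card.
  have lnN_ge0 : 0 <= ln N by rewrite ln_ge0 // ler1n.
  have theta_ge0 : 0 <= theta ^+ r.
    by rewrite exprn_ge0 // invr_ge0 ltW // addr_gt0.
  have gamma_ge0 : 0 <= gamma.
    exact: le_trans le_r.
  have : theta ^+ r * ln N <= gamma * ln #|G|%:R.
    by rewrite ler_pM.
  rewrite [_^-1 * _]mulrC; lra.
suff /exists_inP[u uA /exists_inP[v vA /andP[uv /pred0Pn[x /andP[xu xv]]]]] :
    [exists u in A, exists v in A,
       (u != v) && ~~ [disjoint ball H X u r & ball H X v r]].
  have [p linkp] := ball_meet_link (subsetP AX _ uA) (subsetP AX _ vA) uv xu xv.
  by exists u, v, p.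
apply: contraTT ltA => /exists_inPn disjA; rewrite -leNgt.
have le_sum : (\sum_(u in A) #|ball H X u r| <= #|H|)%N.
  have ballE u : u \in A ->
      #|ball H X u r| = (\sum_(x in H) (x \in ball H X u r))%N.
    move=> uA; rewrite -sum1_card [LHS]big_mkcond [RHS]big_mkcond /=.
    apply: eq_bigr => x _; have := subsetP (ball_sub X r (subsetP AH _ uA)) x.
    by case: (x \in ball _ _ _ _) => [->|_] //; case: ifP.
  rewrite (eq_bigr _ ballE) exchange_big -sum1_card; apply: leq_sum => x _.
  have [/exists_inP[u uA xu]|/exists_inPn xA] :=
      boolP [exists u in A, x \in ball H X u r].
    rewrite (bigD1 u) //= xu big1 // => v /andP[vA vu].
    have /exists_inPn/(_ v vA) := disjA u uA.
    rewrite eq_sym vu negbK => /pred0P/(_ x) /=; by rewrite xu /= => ->.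
  by rewrite big1 // => u /xA/negPf->.
rewrite -(ler_pM2r N_gt0) -sum1_card natr_sum mulr_suml.
apply: (@le_trans _ _ (K * \sum_(u in A) #|ball H X u r|%:R)).
  by rewrite mulr_sumr ler_sum // => u /N_le; rewrite mul1r.
by rewrite ler_pM2l // -natr_sum ler_nat.
Qed.

End ExtremalSubgraph.

Lemma dense_graph_links (R : realType) (G : graph) (delta gamma : R) (r : nat) :
    0 < delta -> (1 + delta)^-1 ^+ r <= gamma -> (0 < #|edges G|)%N ->
    let D := #|edges G|%:R / #|G|%:R `^ (1 + delta) in
  exists2 H : {set G}, D <= #|H|%:R &
    forall X A : {set G}, 4 * #|X|%:R <= D -> A \subset H -> A \subset X ->
      4 `^ delta^-1 * #|G|%:R `^ gamma < #|A|%:R ->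
    exists u v p, [/\ u \in A, v \in A, u != v & link X r.*2 u v p].
Proof.
move=> delta_gt0 le_r edges_gt0 D.
have d1_gt0 : 0 < 1 + delta by rewrite addr_gt0.
pose f (S : {set G}) : R := #|arcs S|%:R / #|S|%:R `^ (1 + delta).
pose H : {set G} := [arg max_(S > setT) f S]%O.
have fH S : f S <= f H.
  by rewrite /H; case: arg_maxP => // H' _ /(_ S); apply.
have arcsT_gt0 : (0 < #|arcs [set: G]|)%N.
  by apply: leq_trans (card_edges_leq G).
have DH : D <= f H.
  apply: le_trans (fH setT); rewrite /D /f cardsT.
  rewrite ler_wpM2r ?invr_ge0 ?powR_ge0 //.
  by rewrite ler_nat card_edges_leq.
have G_gt0 : (0 < #|G|)%N.
  move: (leq_trans arcsT_gt0 (card_arcs_leq _)).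
  by rewrite cardsT expn_gt0 orbF.
have D_gt0 : 0 < D by rewrite divr_gt0 ?powR_gt0 ?ltr0n.
have fH_gt0 : 0 < f H by apply: lt_le_trans DH.
have pow_gt0 S : (0 < #|S|)%N -> 0 < #|S|%:R `^ (1 + delta) :> R.
  by move=> S_gt0; rewrite powR_gt0 ?ltr0n.
(* Division by zero gives 0, so [f] vanishes at the empty set, while [f H] is positive. *)
have H_gt0 : (0 < #|H|)%N.
  rewrite lt0n; apply: contraTneq fH_gt0 => H0.
  by rewrite /f H0 powR0 ?gt_eqF // invr0 mulr0 ltxx.
have arcs_le (S : {set G}) : #|arcs S|%:R <= f H * #|S|%:R `^ (1 + delta).
  have [S_gt0|] := ltnP 0 #|S|; first by rewrite -ler_pdivrMr ?pow_gt0 ?fH.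
  rewrite leqn0 => /eqP S0; have := card_arcs_leq S.
  by rewrite S0 leqn0 => /eqP ->; rewrite powR0 ?mulr0 ?gt_eqF.
have arcs_H : #|arcs H|%:R = f H * #|H|%:R `^ (1 + delta).
  by rewrite /f divfK // gt_eqF ?pow_gt0.
exists H.
  apply: le_trans DH _; exact: extremal_card_ge arcs_H.
move=> X A leX AH AX; have leX' := le_trans leX DH.
exact: (extremal_links delta_gt0 fH_gt0 H_gt0 arcs_le arcs_H le_r leX' AH AX).
Qed.

(** * Choice of the parameters *)

(** Since [T * s ^ 4 = 2 * q * s ^ 5], each of the two hypotheses bounds one summand by
    [q * s ^ 5]. *)
Lemma choice_parameters (q s t T : nat) : (0 < q)%N ->
    (128 * q * t ^ 8 < s ^ 3)%N -> (32 * q ^ 3 * t <= s)%N ->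
    T = (q * s).*2 ->
  ((T ^ 2 * (t ^ 2 + t) ^ 4 + T ^ 4 * t).*2 < T * s ^ 4)%N.
Proof.
move=> q_gt0 lt1 le2 defT.
have s_gt0 : (0 < s)%N by case: s lt1 {le2 defT} => //; rewrite exp0n.
have le3 : ((t ^ 2 + t) ^ 4 <= 16 * t ^ 8)%N.
  rewrite (_ : 16 * t ^ 8 = (2 * t ^ 2) ^ 4)%N; last by ring.
  by rewrite leq_exp2r // mul2n -addnn leq_add2l; case: t {lt1 le2} => // t;
    rewrite expnS leq_pmulr.
have lt1' : (q * s ^ 2 * (128 * q * t ^ 8) < q * s ^ 2 * s ^ 3)%N.
  by rewrite ltn_pmul2l // muln_gt0 q_gt0 expn_gt0 s_gt0.
have le2' : (q * s ^ 4 * (32 * q ^ 3 * t) <= q * s ^ 4 * s)%N.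
  by rewrite leq_mul2l le2 orbT.
have le3' : (T ^ 2 * (t ^ 2 + t) ^ 4 <= T ^ 2 * (16 * t ^ 8))%N.
  by rewrite leq_mul2l le3 orbT.
have TE : T = (2 * q * s)%N by rewrite defT -mul2n mulnA.
rewrite -mul2n; apply: (@leq_ltn_trans
  (q * s ^ 2 * (128 * q * t ^ 8) + q * s ^ 4 * (32 * q ^ 3 * t))).
  apply: (@leq_trans (2 * (T ^ 2 * (16 * t ^ 8) + T ^ 4 * t))).
    by rewrite leq_mul2l /= leq_add2r.
  by apply: eq_leq; rewrite TE; ring.
apply: (@leq_trans (q * s ^ 2 * s ^ 3 + q * s ^ 4 * s)%N).
  by rewrite -addSn leq_add.
by apply: eq_leq; rewrite TE; ring.
Qed.

(** Bernoulli's inequality makes any [r] above [(gamma * delta)^-1] suitable. *)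
Lemma exists_small_expr (R : realType) (delta gamma : R) :
  0 < delta -> 0 < gamma -> exists r, (1 + delta)^-1 ^+ r <= gamma.
Proof.
move=> d_gt0 g_gt0; have d1_gt0 : 0 < 1 + delta by rewrite addr_gt0.
have bernoulli k : 1 + k%:R * delta <= (1 + delta) ^+ k.
  elim: k => [|k IH]; first by rewrite mul0r addr0 expr0.
  rewrite exprS -natr1; apply: le_trans (ler_wpM2l (ltW d1_gt0) IH).
  have : 0 <= k%:R * delta ^+ 2 by rewrite mulr_ge0 // sqr_ge0.
  lra.
exists (Num.truncn (gamma * delta)^-1).+1; set r := _.+1.
rewrite exprVn invf_ple ?posrE ?exprn_gt0 //.
apply: le_trans (bernoulli r); rewrite ler_wpDl //.
rewrite -ler_pdivrMr // -invfM ltW //; exact: truncnS_gt.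
Qed.

Lemma subset_of_card (V : finType) (A : {set V}) (k : nat) :
  (k <= #|A|)%N -> exists2 B : {set V}, B \subset A & #|B| = k.
Proof.
case/card_geqP=> s [us sz sA]; exists [set x in s].
  by apply/subsetP => x; rewrite inE; apply: sA.
by rewrite cardsE (card_uniqP us).
Qed.

Theorem theorem4 (R : realType) (eps : R) (heps : 0 < eps <= 1) :
  exists n0 d : nat, forall G : graph,
    (n0 <= #|G|)%N ->
    (#|G|%:R : R) `^ (1 + eps) <= #|edges G|%:R ->
    is_d_minor d (complete (Num.truncn ((#|G|%:R : R) `^ (eps / 6)))) G.
Proof.
(* With delta = 5 eta and x = n^eta, the parameters satisfy q = O(x),
   t <= x^17 (as 100 / 6 < 17), s ~ x^46 and c >= x^95: dependent random choice
   needs q t^8 << s^3, that is 1 + 8 * 17 < 3 * 46, and the linkage needs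
   (q s)^2 << c, that is 2 * 47 < 95. *)
case/andP: heps => eps_gt0 _; pose eta := eps / 100.
have eta_gt0 : 0 < eta by rewrite divr_gt0.
have epsE : eps = 100 * eta by rewrite /eta; field.
have delta_gt0 : 0 < 5 * eta by rewrite mulr_gt0.
have [r le_r] := exists_small_expr delta_gt0 eta_gt0.
pose K : R := 4 `^ (5 * eta)^-1; pose l := r.*2.
have K_ge1 : 1 <= K.
  by rewrite -[leLHS](powRr0 4) ler_powR ?ler1n // invr_ge0 ltW.
(* [M] absorbs every constant factor below into a single factor [x]; [n0] is chosen so that
   [M <= x]. *)
pose M : R := 128 * l.+1%:R * K ^+ 3 + 1.
have K_ge0 : 0 <= K by apply: le_trans K_ge1.
have M_ge1 : 1 <= M by rewrite lerDr !mulr_ge0 ?exprn_ge0.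
have M_ge0 : 0 <= M by apply: le_trans M_ge1.
exists (Num.truncn (M `^ eta^-1)).+1, l.+1 => G leG le_edges.
set n : R := #|G|%:R in le_edges *.
have n_gt : M `^ eta^-1 < n.
  by apply: lt_le_trans (truncnS_gt _) _; rewrite ler_nat.
have n_gt0 : 0 < n by apply: le_lt_trans n_gt; apply: powR_ge0.
have n_ge1 : 1 <= n by rewrite ler1n -(ltr0n R).
pose x := n `^ eta.
have Mx : M <= x.
  rewrite -[leLHS]powRr1 // -(mulVf (lt0r_neq0 eta_gt0)) powRrM.
  by apply: ge0_ler_powR; rewrite ?nnegrE ?powR_ge0 ?(ltW n_gt) ?ltW.
have x_ge1 : 1 <= x by apply: le_trans Mx.
have x_gt0 : 0 < x by apply: lt_le_trans x_ge1.
have L_ge1 : 1 <= l.+1%:R :> R by rewrite ler1n.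
have K2_ge1 : 1 <= K ^+ 2 by rewrite exprn_ege1.
have K3E : K ^+ 3 = K ^+ 2 * K by rewrite exprSr.
have LK3 : K ^+ 3 <= l.+1%:R * K ^+ 3 by rewrite ler_peMl // exprn_ge0.
have K3_ge0 : 0 <= K ^+ 3 by rewrite exprn_ge0.
have x_ge64 : 64 * l.+1%:R * K ^+ 2 <= x.
  apply: le_trans Mx; have : l.+1%:R * K ^+ 2 <= l.+1%:R * K ^+ 3.
    by rewrite ler_pM2l ?ltr0n // K3E ler_peMr // ltW // (lt_le_trans ltr01).
  rewrite /M; lra.
have x_gt128 : 128 * K < x.
  apply: lt_le_trans Mx; have : K <= K ^+ 3 by rewrite K3E ler_peMl.
  rewrite /M; lra.
have x_ge32 : 32 * K ^+ 3 <= x by apply: le_trans Mx; rewrite /M; lra.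
have x_ge0 : 0 <= x by apply: ltW.
have powx k : x ^+ k = n `^ (k%:R * eta).
  by rewrite -powR_mulrn ?ltW // -powRrM mulrC.
set t := Num.truncn _.
have t_le : t%:R <= x ^+ 17.
  apply: le_trans (_ : n `^ (eps / 6) <= _).
    by rewrite truncn_le powR_ge0.
  by rewrite powx ler_powR // epsE; lra.
pose q := Num.truncn (K * x).
have Kx_ge1 : 1 <= K * x by rewrite mulr_ege1.
have q_gt0 : (0 < q)%N by rewrite truncn_gt0.
have q_le : q%:R <= K * x by rewrite truncn_le (le_trans ler01).
pose s := (Num.truncn (x ^+ 46)).+1.
have x46_ge1 : 1 <= x ^+ 46 by rewrite exprn_ege1.
have s_gt : x ^+ 46 < s%:R by apply: truncnS_gt.
have s_le : s%:R <= 2 * x ^+ 46.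
  have : (Num.truncn (x ^+ 46))%:R <= x ^+ 46.
    by rewrite truncn_le (le_trans ler01).
  rewrite /s -natr1; lra.
pose T := (q * s).*2.
pose D : R := #|edges G|%:R / n `^ (1 + 5 * eta).
have D_ge : x ^+ 95 <= D.
  rewrite ler_pdivlMr ?powR_gt0 // powx -powRD; last first.
    by rewrite (gt_eqF n_gt0) implybT.
  by apply: le_trans le_edges; rewrite ler_powR // epsE; lra.
have edges_gt0 : (0 < #|edges G|)%N.
  by rewrite -(ltr0n R); apply: lt_le_trans le_edges; rewrite powR_gt0.
have [H leH linksH] := dense_graph_links delta_gt0 le_r edges_gt0.
rewrite -/n -/D in leH; rewrite -/n -/x -/K -/l -/D in linksH.
(* Since [T <= 4 * K * x ^ 47] and [m <= l.+1 * T ^ 2], the left side is at most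
   [64 * l.+1 * K ^ 2 * x ^ 94], and the constants cost at most one more [x]. *)
have X_small (m : nat) : (m <= T + l * T ^ 2)%N -> 4 * m%:R <= D.
  move=> le_m; apply: le_trans D_ge.
  have T_le : T%:R <= 4 * K * x ^+ 47.
    have : q%:R * s%:R <= (K * x) * (2 * x ^+ 46) by rewrite ler_pM.
    rewrite /T -muln2 !natrM [x ^+ 47]exprS; lra.
  have m_le : m%:R <= l.+1%:R * T%:R ^+ 2 :> R.
    rewrite -natrX -natrM ler_nat (leq_trans le_m) // mulSn leq_add2r.
    by rewrite -mulnn leq_pmulr // double_gt0 muln_gt0 q_gt0.
  have T2_le : T%:R ^+ 2 <= (4 * K * x ^+ 47) ^+ 2.
    by rewrite lerXn2r ?nnegrE // (le_trans _ T_le).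
  apply: (@le_trans _ _ (4 * (l.+1%:R * (4 * K * x ^+ 47) ^+ 2))).
    by rewrite ler_pM2l // (le_trans m_le) // ler_pM2l ?ltr0n.
  have -> : 4 * (l.+1%:R * (4 * K * x ^+ 47) ^+ 2) =
    64 * l.+1%:R * K ^+ 2 * x ^+ 94 by ring.
  by rewrite [x ^+ 95]exprS ler_pM2r ?exprn_gt0.
(* There is room for [C] because [T <= 4 * T <= D <= #|H|]. *)
have [C CH CT] : exists2 C : {set G}, C \subset H & #|C| = T.
  apply: subset_of_card; rewrite -(ler_nat R); apply: le_trans leH.
  apply: le_trans (X_small T (leq_addr _ _)); rewrite ler_peMl // ler1n //.
apply: (@clique_minor_of_links G C l q s t); rewrite CT //.
  move=> X A CX leX AC ltA; apply: linksH => //.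
  - exact: X_small.
  - exact: subset_trans CH.
  - exact: subset_trans CX.
  by rewrite (lt_le_trans (truncnS_gt _)) // ler_nat.
apply: (@choice_parameters q s t T) => //.
  rewrite -(ltr_nat R) !(natrX, natrM).
  apply: (@lt_le_trans _ _ (x ^+ 138)); last first.
    by rewrite (exprM x 46 3) lerXn2r ?nnegrE ?exprn_ge0 // ltW.
  apply: (@le_lt_trans _ _ (128 * (K * x) * x ^+ 136)).
    have t8_le : t%:R ^+ 8 <= x ^+ 136.
      by rewrite (exprM x 17 8) lerXn2r ?nnegrE ?exprn_ge0.
    by apply: ler_pM => //; rewrite ?mulr_ge0 ?exprn_ge0 // ler_pM2l.
  have -> : x ^+ 138 = x * x * x ^+ 136 by ring.
  by rewrite ltr_pM2r ?exprn_gt0 // mulrA ltr_pM2r.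
(* The second condition has much slack: its left side is at most [32 * K ^ 3 * x ^ 20 <= x ^ 21],
   against [x ^ 46]. *)
rewrite -(ler_nat R) !(natrX, natrM); apply: le_trans (ltW s_gt).
apply: (@le_trans _ _ (32 * (K * x) ^+ 3 * x ^+ 17)).
  have q3_le : q%:R ^+ 3 <= (K * x) ^+ 3.
    by rewrite lerXn2r ?nnegrE ?mulr_ge0.
  by apply: ler_pM => //; rewrite ?mulr_ge0 ?exprn_ge0 // ler_pM2l.
have -> : 32 * (K * x) ^+ 3 * x ^+ 17 = 32 * K ^+ 3 * x ^+ 20 by ring.
apply: (@le_trans _ _ (x * x ^+ 20)).
  by rewrite ler_pM2r ?exprn_gt0.
by rewrite -exprS ler_weXn2l.
Qed.
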